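(* Let $n\ge1$ and $0\le k\le n$, let $f : B\to\triangle^n$ be a fibration of simplicial sets, and let $m : A\to B$ be the pullback of the horn inclusion $\Lambda^n_k\hookrightarrow\triangle^n$ along $f$. Then $m$ is a strong anodyne extension.
   Context: $\triangle^n$ is the standard $n$-simplex and $\Lambda^n_k \hookrightarrow \triangle^n$ ($n\ge 1$, $0\le k\le n$) are the horn inclusions. A fibration is a map of simplicial sets with the right lifting property with respect to all horn inclusions (Kan fibration). Strong anodyne extension: let $m : A \hookrightarrow B$ be a monomorphism of simplicial sets (identify $A$ with its image). An anodyne presentation for $m$ consists of an ordinal $\kappa$ and an increasing family of subcomplexes $(A^\alpha)_{\alpha\le\kappa}$ of $B$ such that: $A^0 = A$ and $A^\kappa = B$; for every non-zero limit ordinal $\lambda\le\kappa$, $\bigcup_{\alpha<\lambda}A^\alpha = A^\lambda$; for every $\alpha<\kappa$ the inclusion $A^\alpha\hookrightarrow A^{\alpha+1}$ is a pushout of a coproduct of horn inclusions. The map $m$ is a strong anodyne extension if it admits an anodyne presentation. (No closure under retracts.) *)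

(* Defs.v *)
From HB Require Import structures.
From mathcomp Require Import all_boot all_order.
From mathcomp Require Import boolp classical_sets wochoice.

Set Implicit Arguments.
Unset Strict Implicit.
Unset Printing Implicit Defensive.

Local Open Scope classical_set_scope.

(* Morphisms [m] -> [n] of the simplex category, [n] being 'I_n.+1. *)
Notation opmap m n := {omorphism 'I_m.+1 -> 'I_n.+1}.

Definition op_id (n : nat) : opmap n n := idfun.

Definition op_comp (m n p : nat) (g : opmap n p) (f : opmap m n) : opmap m p :=
  g \o f.

Lemma opmap_ext (m n : nat) (f g : opmap m n) : f =1 g -> f = g.
Proof.
case: f g => [f [[Hf]]] [g [[Hg]]] /= /funext fg.
by move: Hf Hg; rewrite fg => Hf Hg; rewrite (Prop_irrelevance Hf Hg).
Qed.

Record sset := SSet {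
  simplices :> nat -> Type;
  act : forall m n : nat, opmap m n -> simplices n -> simplices m;
  act_id : forall (n : nat) (x : simplices n), act (op_id n) x = x;
  act_comp : forall (m n p : nat) (g : opmap n p) (f : opmap m n)
    (x : simplices p), act (op_comp g f) x = act f (act g x) }.

Arguments act {s m n} _ _.

Record smap (X Y : sset) := SMap {
  smap_fun :> forall n : nat, X n -> Y n;
  smap_nat : forall (m n : nat) (f : opmap m n) (x : X n),
    smap_fun (act f x) = act f (smap_fun x) }.

Arguments smap_fun {X Y} _ n _.

Lemma smap_ext (X Y : sset) (f g : smap X Y) :
  (forall (n : nat) (x : X n), f n x = g n x) -> f = g.
Proof.
case: f g => [f Hf] [g Hg] /= fg.
have {}fg : f = g by apply: functional_extensionality_dep => n; apply/funext.
by move: Hf Hg; rewrite fg => Hf Hg; rewrite (Prop_irrelevance Hf Hg).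
Qed.

Definition smap_comp (X Y Z : sset) (g : smap Y Z) (f : smap X Y) : smap X Z.
Proof.
exists (fun n x => g n (f n x)) => m n h x.
by rewrite !smap_nat.
Defined.

Notation "g ∘ f" := (smap_comp g f) (at level 40, left associativity).

(* Lifting against commutative squares. *)
Definition has_rlp (X Y : sset) (f : smap X Y) (A B : sset) (i : smap A B) :
    Prop :=
  forall (u : smap A X) (v : smap B Y), f ∘ u = v ∘ i ->
  exists h : smap B X, h ∘ i = u /\ f ∘ h = v.

Definition is_mono (X Y : sset) (f : smap X Y) : Prop :=
  forall (Z : sset) (g h : smap Z X), f ∘ g = f ∘ h -> g = h.

(*   P --q--> X
     |p       |f
     v        v
     Y --g--> Z  *)
Definition is_pullback (P X Y Z : sset)
    (p : smap P Y) (q : smap P X) (g : smap Y Z) (f : smap X Z) : Prop :=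
  g ∘ p = f ∘ q /\
  forall (T : sset) (a : smap T Y) (b : smap T X), g ∘ a = f ∘ b ->
  exists! h : smap T P, p ∘ h = a /\ q ∘ h = b.

(*   A --u--> X
     |g       |i
     v        v
     B --v--> Y  *)
Definition is_pushout (A B X Y : sset)
    (g : smap A B) (u : smap A X) (v : smap B Y) (i : smap X Y) : Prop :=
  i ∘ u = v ∘ g /\
  forall (T : sset) (a : smap X T) (b : smap B T), a ∘ u = b ∘ g ->
  exists! h : smap Y T, h ∘ i = a /\ h ∘ v = b.

Definition is_pushout_of (A B X Y : sset) (g : smap A B) (i : smap X Y) :
    Prop :=
  exists (u : smap A X) (v : smap B Y), is_pushout g u v i.

Definition coprod (J : Type) (X : J -> sset) : sset.
Proof.
exists (fun n => {j : J & X j n})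
  (fun m n f x => existT (fun j => X j m) (projT1 x) (act f (projT2 x))).
- by move=> n [j x] /=; rewrite act_id.
- by move=> m n p g f [j x] /=; rewrite act_comp.
Defined.

Definition coprod_map (J : Type) (X Y : J -> sset)
  (f : forall j, smap (X j) (Y j)) : smap (coprod X) (coprod Y).
Proof.
exists (fun n (x : coprod X n) =>
  existT (fun j => Y j n) (projT1 x) (f (projT1 x) n (projT2 x))).
by move=> m n h [j x] /=; rewrite smap_nat.
Defined.

Record subcomplex (X : sset) := Subcomplex {
  sub_simplices :> forall n : nat, set (X n);
  sub_act : forall (m n : nat) (f : opmap m n) (x : X n),
    sub_simplices x -> sub_simplices (act f x) }.

Arguments sub_simplices {X} _ n _.

Definition sub_le (X : sset) (A B : subcomplex X) : Prop :=
  forall n : nat, A n `<=` B n.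

Definition sub_sset (X : sset) (A : subcomplex X) : sset.
Proof.
exists (fun n => {x : X n | A n x})
  (fun m n f x => exist (A m) (act f (sval x)) (sub_act f (svalP x))).
- by move=> n [x Ax]; apply: eq_exist; rewrite /= act_id.
- by move=> m n p g f [x Ax]; apply: eq_exist; rewrite /= act_comp.
Defined.

Definition sub_inj (X : sset) (A : subcomplex X) : smap (sub_sset A) X.
Proof. by exists (fun n (x : sub_sset A n) => sval x). Defined.

Definition sub_incl (X : sset) (A B : subcomplex X) (AB : sub_le A B) :
  smap (sub_sset A) (sub_sset B).
Proof.
exists (fun n (x : sub_sset A n) =>
  exist (B n) (sval x) (AB n (sval x) (svalP x))).
by move=> m n f [x Ax]; apply: eq_exist.
Defined.

Definition simplex (n : nat) : sset.
Proof.
exists (fun m => opmap m n) (fun m p f x => op_comp x f).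
- by move=> m x; apply: opmap_ext.
- by move=> m p q g f x; apply: opmap_ext.
Defined.

(* The union of the faces of the simplex opposite to the vertices i <> k: a
   simplex lies in the i-th face iff its image misses i. *)
Definition horn (n : nat) (k : 'I_n.+1) : subcomplex (simplex n).
Proof.
exists (fun m => [set x : opmap m n |
  exists i : 'I_n.+1, i <> k /\ forall j : 'I_m.+1, x j <> i]).
move=> m p f x [i [ik xi]]; exists i; split=> // j; exact: xi.
Defined.

Definition horn_incl (n : nat) (k : 'I_n.+1) :
  smap (sub_sset (horn k)) (simplex n) := sub_inj (horn k).

Definition is_fibration (X Y : sset) (f : smap X Y) : Prop :=
  forall (n : nat) (k : 'I_n.+1), 0 < n -> has_rlp f (horn_incl k).

Definition is_pushout_of_horns (X Y : sset) (i : smap X Y) : Prop :=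
  exists (J : Type) (d : J -> nat) (k : forall j : J, 'I_(d j).+1),
    (forall j : J, 0 < d j) /\
    is_pushout_of (coprod_map (fun j : J => horn_incl (k j))) i.

Definition is_succ (d : Order.disp_t) (K : porderType d) (a b : K) : Prop :=
  (a < b)%O /\ forall c : K, (a < c)%O -> (b <= c)%O.

Definition is_limit (d : Order.disp_t) (K : bPOrderType d) (l : K) : Prop :=
  l <> \bot%O /\ forall a : K, ~ is_succ a l.

(* The ordinal kappa is given through the well-ordered set K of all the ordinals
   alpha <= kappa, whose least element \bot is 0 and whose greatest element \top
   is kappa (kappa = 0 is the case \bot = \top). *)
Record anodyne_presentation (A B : sset) (m : smap A B)
    (d : Order.disp_t) (K : tbOrderType d) (F : K -> subcomplex B) : Prop :=
  AnodynePresentation {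
  ap_wo : well_order (<=%O : rel K);
  ap_le : forall a b : K, (a <= b)%O -> sub_le (F a) (F b);
  ap_bot : forall n : nat, F \bot%O n = range (m n);
  ap_top : forall n : nat, F \top%O n = setT;
  ap_limit : forall l : K, is_limit l ->
    forall n : nat, F l n = \bigcup_(a in [set b : K | (b < l)%O]) F a n;
  ap_succ : forall (a b : K) (ab : (a <= b)%O), is_succ a b ->
    is_pushout_of_horns (sub_incl (ap_le ab)) }.

Definition strong_anodyne (A B : sset) (m : smap A B) : Prop :=
  is_mono m /\
  exists (d : Order.disp_t) (K : tbOrderType d) (F : K -> subcomplex B),
    anodyne_presentation m F.

(* Main.v *)
From HB Require Import structures.
From mathcomp Require Import all_boot all_order.
From mathcomp Require Import boolp classical_sets wochoice.
From mathcomp Require Import zify.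
Require Import Defs.

Set Implicit Arguments.
Unset Strict Implicit.
Unset Printing Implicit Defensive.

(** Call a vertex of a simplex x of B a k-vertex if f sends it to k. If some
    vertex of x is not a k-vertex, then f lets one build a cone C x over x: a
    simplex with one more vertex, a new k-vertex placed just before those of x,
    whose face opposite to that vertex is x. It is obtained by filling: the
    faces of C x opposite to the old k-vertices are prescribed to be the cones
    on the corresponding faces of x, the other faces are left free, and there is
    at least one of the latter because x has a vertex that is not a k-vertex. A
    nonempty proper set of faces of a simplex can always be filled along a
    fibration ([fill_faces]). Doing this by induction on the dimension, one can
    make C commute with faces at k-vertices and with degeneracies, and be a
    contraction, in the sense that the cone on a cone is degenerate
    ([exists_cone]).

    Now let A be the part of B over the horn; every simplex outside A has a
    vertex that is not a k-vertex. The nondegenerate simplices outside A fall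
    into pairs (x, C x), where x runs over those that are not themselves cones,
    called generating below. Attaching C x to a subcomplex containing all its
    faces but x is a pushout of the horn of C x that omits the face x. To order
    these attachments, give every simplex the weight: number of vertices plus
    number of vertices that are not k-vertices. A face of C x other than x
    either is opposite to a k-vertex, and then it is the cone on a simplex of
    smaller weight than x, or it is opposite to another vertex, and then removing
    that vertex lowers the weight by 2, while passing from x to C x raises it by
    1, so that the face has itself a smaller weight than x ([generating_face]).
    Hence attaching all generating x of weight t, together with their cones, at
    stage t presents the inclusion of A in B, with length the ordinal omega. *)

(** * Operators of the simplex category *)

Lemma op_ext (m n : nat) (f g : opmap m n) :
  (forall i : 'I_m.+1, f i = g i :> nat) -> f = g.
Proof. by move=> fg; apply: opmap_ext => i; apply: val_inj; exact: fg. Qed.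

Lemma op_homo (m n : nat) (f : opmap m n) (i j : 'I_m.+1) :
  i <= j -> f i <= f j.
Proof. by move=> ij; exact: (Order.OrderMorphismTheory.omorph_le f ij). Qed.

(** Faces and degeneracies are indexed by plain natural numbers, and operators
    are built from functions on naturals, so that identities between them reduce
    to linear arithmetic. *)
Section MkOp.
Variables (m n : nat) (h : nat -> nat).
Hypothesis h_bound : forall i, i <= m -> h i <= n.
Hypothesis h_homo : forall i j, i <= j -> j <= m -> h i <= h j.

Definition mk_op_fun (i : 'I_m.+1) : 'I_n.+1 :=
  Ordinal (h_bound (ltn_ord i) : h i < n.+1).

Fact mk_op_homo : {homo mk_op_fun : i j / (i <= j)%O >-> (i <= j)%O}.
Proof. by move=> i j ij; apply: (h_homo ij (ltn_ord j)). Qed.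

HB.instance Definition _ :=
  Order.isOrderMorphism.Build _ 'I_m.+1 _ 'I_n.+1 mk_op_fun mk_op_homo.

Definition mk_op : opmap m n := mk_op_fun.
End MkOp.

Fact coface_bound m i j : j <= m -> bump i j <= m.+1.
Proof. rewrite /bump; lia. Qed.
Fact coface_homo m i j l : j <= l -> l <= m -> bump i j <= bump i l.
Proof. by rewrite leq_bump2. Qed.
Definition coface m i : opmap m m.+1 :=
  mk_op (@coface_bound m i) (@coface_homo m i).

(* The truncation by [minn m] only matters for i > m, where [unbump i] would
   leave the range. *)
Fact codegen_bound m i j : j <= m.+1 -> minn m (unbump i j) <= m.
Proof. lia. Qed.
Fact codegen_homo m i j l : j <= l -> l <= m.+1 ->
  minn m (unbump i j) <= minn m (unbump i l).
Proof. rewrite /unbump; lia. Qed.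
Definition codegen m i : opmap m.+1 m :=
  mk_op (@codegen_bound m i) (@codegen_homo m i).

(** * Simplicial identities *)

Section Simplicial.
Variable X : sset.

Definition face m i (x : X m.+1) : X m := act (coface m i) x.
Definition degen m i (x : X m) : X m.+1 := act (codegen m i) x.

Lemma act_eq m n (f g : opmap m n) (x : X n) :
  (forall i : 'I_m.+1, f i = g i :> nat) -> act f x = act g x.
Proof. by move=> /op_ext ->. Qed.

Lemma face_face m i j (x : X m.+2) : i <= j ->
  face i (face j.+1 x) = face j (face i x).
Proof.
move=> ij; rewrite /face -!act_comp; apply: act_eq => l /=; rewrite /bump; lia.
Qed.

Lemma face_degen m i (x : X m) : i <= m -> face i (degen i x) = x.
Proof.
move=> ij; rewrite /face /degen -!act_comp -[RHS]act_id; apply: act_eq => l /=.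
have := ltn_ord l; rewrite /bump /unbump; lia.
Qed.

Lemma faceS_degen m i (x : X m) : i <= m -> face i.+1 (degen i x) = x.
Proof.
move=> ij; rewrite /face /degen -!act_comp -[RHS]act_id; apply: act_eq => l /=.
have := ltn_ord l; rewrite /bump /unbump; lia.
Qed.

Lemma face_degen_lt m i j (x : X m.+1) : i <= j -> j <= m ->
  face i (degen j.+1 x) = degen j (face i x).
Proof.
move=> ij jm; rewrite /face /degen -!act_comp; apply: act_eq => l /=.
have := ltn_ord l; rewrite /bump /unbump; lia.
Qed.

Lemma face_degen_gt m i j (x : X m.+1) : j < i -> i <= m.+1 ->
  face i.+1 (degen j x) = degen j (face i x).
Proof.
move=> ij jm; rewrite /face /degen -!act_comp; apply: act_eq => l /=.
have := ltn_ord l; rewrite /bump /unbump; lia.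
Qed.

Lemma degen_degen m i j (x : X m) : i <= j -> j <= m ->
  degen i (degen j x) = degen j.+1 (degen i x).
Proof.
move=> ij jm; rewrite /degen -!act_comp; apply: act_eq => l /=.
have := ltn_ord l; rewrite /unbump; lia.
Qed.

End Simplicial.

(** * Filling sets of faces along a fibration *)

Lemma neq_setTP (T : finType) (A : {set T}) :
  reflect (exists x, x \notin A) (A != finset.setT).
Proof.
rewrite -finset.subTset; apply: (iffP subsetPn) => [[x _ xA]|[x xA]];
  by exists x.
Qed.

Lemma coface_factor r m (a : opmap r m.+1) (i : 'I_m.+2) :
  (forall l, a l <> i) -> a = op_comp (coface m i) (op_comp (codegen m i) a).
Proof.
move=> ai; apply: op_ext => l /=.
have ail : a l <> i :> nat by move=> /val_inj/ai.
have := ltn_ord i; have := ltn_ord (a l); rewrite /bump /unbump; lia.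
Qed.

Lemma coface_mono r m i (a b : opmap r m) :
  op_comp (coface m i) a = op_comp (coface m i) b -> a = b.
Proof.
move=> ab; apply: op_ext => l.
have /(congr1 val) : op_comp (coface m i) a l = op_comp (coface m i) b l.
  by rewrite ab.
by move=> /= /(can_inj (bumpK i)) ->.
Qed.

Lemma coface_neq m i (l : 'I_m.+1) : coface m i l <> i :> nat.
Proof. by apply/eqP; rewrite eq_sym /= neq_bump. Qed.

(** The simplicial identities for two faces in a uniform shape, valid for all
    i and j, as [face i (face j x)] removes the vertices j and [bump j i]. *)
Lemma face_face_bump (X : sset) m j i (x : X m.+2) :
  face i (face j x) = face (unbump i j) (face (bump j i) x).
Proof.
rewrite /face -!act_comp; apply: act_eq => l /=; rewrite /bump /unbump; lia.
Qed.

Definition yoneda (X : sset) m (x : X m) : smap (simplex m) X.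
Proof.
exists (fun r (a : simplex m r) => act (a : opmap r m) x) => r q g a.
by rewrite -act_comp.
Defined.

Section Fill.
Variables (X Y : sset) (f : smap X Y) (hf : is_fibration f).

(** Stated with all operators rather than pairs of faces, so that it makes sense
    for points (m = 0) as well, and transports along composition. *)
Definition compatible m (I : {set 'I_m.+2}) (x : 'I_m.+2 -> X m) :=
  forall i j, i \in I -> j \in I -> forall r (a b : opmap r m),
    op_comp (coface m i) a = op_comp (coface m j) b -> act a (x i) = act b (x j).

(** The map out of a horn glued from a compatible family: a simplex of the horn
    factors through some face other than the k-th, and compatibility says that
    the choice of that face does not matter. *)
Section HornMap.
Variables (m : nat) (k : 'I_m.+2) (x : 'I_m.+2 -> X m).
Hypothesis cx : compatible (~: [set k]) x.

Definition horn_map_fun r (t : sub_sset (horn k) r) : X r :=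
  let i := sval (cid (svalP t)) in act (op_comp (codegen m i) (sval t)) (x i).

Lemma horn_map_funE r (t : sub_sset (horn k) r) i (a : opmap r m) :
  i <> k -> sval t = op_comp (coface m i) a -> horn_map_fun t = act a (x i).
Proof.
move=> ik ta; rewrite /horn_map_fun; case: cid => j [jk tj] /=.
apply: cx; rewrite ?inE; try exact/eqP.
by rewrite -coface_factor.
Qed.

Definition horn_map : smap (sub_sset (horn k)) X.
Proof.
exists horn_map_fun => r q g t.
have [i [ik ti]] := svalP t; have tE := coface_factor ti.
rewrite (horn_map_funE ik tE) -act_comp; apply: (horn_map_funE ik) => /=.
by apply: opmap_ext => l; have := congr1 (fun u : opmap _ _ => u (g l)) tE.
Defined.
End HornMap.

Lemma fill_horn m (k : 'I_m.+2) (x : 'I_m.+2 -> X m) (v : Y m.+1) :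
  compatible (~: [set k]) x -> (forall i, i <> k -> f m (x i) = face i v) ->
  exists z : X m.+1, f _ z = v /\ forall i, i <> k -> face i z = x i.
Proof.
move=> cx fx.
have [|h [hu fh]] := hf (k := k) isT (u := horn_map cx) (v := yoneda v).
  apply: smap_ext => r t.
  have [i [ik ti]] := svalP t; have tE := coface_factor ti.
  have := horn_map_funE cx ik tE => /= ->.
  by rewrite smap_nat fx // {2}tE /face -act_comp.
exists (h m.+1 (op_id m.+1)); split.
  have /= := congr1 (fun u : smap (simplex m.+1) Y => u m.+1 (op_id m.+1)) fh.
  by rewrite act_id.
move=> i ik; rewrite /face -smap_nat.
have hi : (horn k) m (coface m i).
  by exists i; split=> // j /(congr1 val); apply: coface_neq.
have := congr1 (fun u : smap (sub_sset (horn k)) X => u m (exist _ _ hi)) hu.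
rewrite /= (@horn_map_funE _ _ _ cx _ _ i (op_id m)) //=; last first.
  exact: opmap_ext.
by rewrite act_id => <-; congr (h _ _); apply: opmap_ext.
Qed.

(** Horns are the case of all faces but one. If at least two faces j and j' are
    missing, the j-th one can be added: its own faces shared with the given
    family form a set of faces of a simplex of one dimension less, which is
    nonempty because the given set is, and proper because j' is missing. *)
Lemma fill_faces m (I : {set 'I_m.+2}) (x : 'I_m.+2 -> X m) (v : Y m.+1) :
  I != finset.set0 -> I != finset.setT -> compatible I x ->
  (forall i, i \in I -> f m (x i) = face i v) ->
  exists z : X m.+1, f _ z = v /\ forall i, i \in I -> face i z = x i.
Proof.
elim: m I x v => [|m IHm] I x v.
  move=> I0 /neq_setTP/=[k kI] cx fx.
  have IE : I = ~: [set k].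
    apply/setP => i; rewrite !inE; apply/idP/idP.
      by apply: contraTneq => ->.
    move=> ik; case/finset.set0Pn: I0 => j jI.
    have jk : j != k by apply: contraTneq jI => ->.
    suff -> : i = j by [].
    apply/val_inj; move: ik jk; rewrite -!val_eqE /=.
    by have := ltn_ord i; have := ltn_ord j; have := ltn_ord k; lia.
  rewrite IE in cx fx *; have [|z [fz zx]] := fill_horn cx (v := v).
    by move=> i ik; apply: fx; rewrite !inE; apply/eqP.
  by exists z; split=> // i; rewrite !inE => /eqP; apply: zx.
(* Now induct on the number of missing faces. *)
have [c] := ubnP #|~: I|; elim: c I x => // c IHc I x cI I0 IT cx fx.
have /neq_setTP[j jI] := IT.
have [IE|/neq_setTP[j']] := eqVneq (j |: I) finset.setT.
  have {}IE : I = ~: [set j].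
    apply/setP => i; move/setP: IE => /(_ i); rewrite !inE.
    by case: eqVneq => [-> _|//]; exact/negbTE.
  rewrite IE in cx fx *; have [|z [fz zx]] := fill_horn cx (v := v).
    by move=> i ik; apply: fx; rewrite !inE; apply/eqP.
  by exists z; split=> // i; rewrite !inE => /eqP; apply: zx.
rewrite !inE negb_or => /andP[j'j j'I].
pose L (i : 'I_m.+2) : 'I_m.+3 := lift j i.
pose I' := [set i : 'I_m.+2 | L i \in I].
pose y (i : 'I_m.+2) : X m := face (unbump i j) (x (L i)).
have neqL i : j != i -> exists i', i = L i'.
  by move=> ji; have [i' -> _] := unlift_some ji; exists i'.
have ddL (i : 'I_m.+2) : op_comp (coface m.+1 j) (coface m i) =
    op_comp (coface m.+1 (L i)) (coface m (unbump i j)).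
  apply: op_ext => l /=; rewrite /bump /unbump; lia.
have opA := fun r (a : opmap r m) i j => @opmap_ext _ _
  (op_comp (coface m.+1 i) (op_comp (coface m j) a))
  (op_comp (op_comp (coface m.+1 i) (coface m j)) a) (fun=> erefl).
have [||||w [fw wy]] := IHm I' y (face j v).
- have /finset.set0Pn[i iI] := I0; have [|i' iE] := neqL i.
    by apply: contraNneq jI => ->.
  by apply/finset.set0Pn; exists i'; rewrite inE -iE.
- have [|i' iE] := neqL j'; first by rewrite eq_sym.
  by apply/neq_setTP; exists i'; rewrite inE -iE.
- move=> i i'; rewrite !inE => iI i'I r a b ab.
  rewrite /y /face -!act_comp; apply: cx => //.
  by rewrite !opA -!ddL -!opA ab.
- move=> i; rewrite inE => iI.
  by rewrite /y smap_nat fx // [RHS]face_face_bump.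
pose x' i := if i == j then w else x i.
have x'j : x' j = w by rewrite /x' eqxx.
have x'I i : i \in I -> x' i = x i.
  by rewrite /x'; case: eqP jI => // -> /negbTE->.
have wx i r (a b : opmap r m.+1) : i \in I ->
    op_comp (coface m.+1 j) a = op_comp (coface m.+1 i) b -> act a w = act b (x i).
  move=> iI ab; have [|i' iE] := neqL i; first by apply: contraNneq jI => ->.
  have ai l : a l <> i'.
    move=> al; have := @coface_neq m.+1 i (b l); apply.
    have := congr1 (fun u : opmap _ _ => val (u l)) ab => /= <-.
    by rewrite al iE.
  have aE := coface_factor ai; set e := op_comp _ a in aE.
  have -> : b = op_comp (coface m (unbump i' j)) e.
    by apply: (@coface_mono _ _ i); rewrite -ab aE !opA ddL iE.
  rewrite aE !act_comp; have := wy i'; rewrite inE -iE => /(_ iI).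
  by rewrite /face => ->; rewrite /y /face iE.
have [|||||z [fz zx]] := IHc (j |: I) x'.
- rewrite -ltnS; apply: leq_trans cI; rewrite ltnS.
  apply: proper_card; apply/fintype.properP; split.
    by apply/fintype.subsetP => i; rewrite !inE negb_or => /andP[].
  by exists j; rewrite !inE ?eqxx.
- by apply/finset.set0Pn; exists j; rewrite !inE eqxx.
- by apply/neq_setTP; exists j'; rewrite !inE negb_or j'j.
- move=> i i'; rewrite !inE => /predU1P[->|iI] /predU1P[->|i'I] r a b ab.
  + by rewrite (coface_mono ab).
  + by rewrite x'j x'I //; apply: wx.
  + by rewrite x'j x'I //; apply/esym/wx.
  + by rewrite !x'I //; apply: cx.
- by move=> i; rewrite !inE => /predU1P[->|iI]; rewrite ?x'j ?x'I ?fx.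
exists z; split=> // i iI; rewrite zx ?x'I //.
by rewrite !inE iI orbT.
Qed.

(** In positive dimension two distinct faces of a simplex meet in a common
    face, so the usual pairwise conditions suffice. *)
Lemma compatible_faces m (I : {set 'I_m.+3}) (x : 'I_m.+3 -> X m.+1) :
  (forall i j, i \in I -> j \in I -> i < j -> face i (x j) = face j.-1 (x i)) ->
  compatible I x.
Proof.
move=> cx i j iI jI r.
wlog ij : i j iI jI / i <= j => [H|] a b ab.
  by case/orP: (leq_total i j) => ij; [|symmetry]; apply: H.
move: ij; rewrite leq_eqVlt => /predU1P[/val_inj ij|ij].
  by move: ab; rewrite ij => /coface_mono ->.
have Lj : j.-1 < m.+2 by have := ltn_ord j; lia.
have aj l : a l <> Ordinal Lj.
  move=> al; apply: (@coface_neq m.+1 j (b l)).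
  have := congr1 (fun u : opmap _ _ => val (u l)) ab => /= <-.
  rewrite al /= /bump; lia.
have aE := coface_factor aj; set e := op_comp _ a in aE.
have bE : b = op_comp (coface m i) e.
  apply: (@coface_mono _ _ j); rewrite -ab {1}aE.
  apply: op_ext => l /=; rewrite /bump; lia.
by rewrite aE bE !act_comp; have := cx i j iI jI ij; rewrite /face => ->.
Qed.

End Fill.

(** * Cones at k-vertices *)

Local Ltac ulia := rewrite /bump /unbump; lia.

Section Cone.
Variables (n : nat) (k : 'I_n.+1) (B : sset) (f : smap B (simplex n)).

Definition vtx m (x : B m) (j : nat) : nat := (f m x : opmap m n) (inord j).

Lemma vtx_act m r (g : opmap r m) (x : B m) (j : 'I_r.+1) :
  vtx (act g x) j = vtx x (g j).
Proof. by rewrite /vtx smap_nat /= !inord_val. Qed.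

Lemma vtx_face m i (x : B m.+1) j : j <= m ->
  vtx (face i x) j = vtx x (bump i j).
Proof. by rewrite -ltnS => jm; rewrite (vtx_act _ _ (Ordinal jm)). Qed.

Lemma vtx_degen m i (x : B m) j : j <= m.+1 ->
  vtx (degen i x) j = vtx x (minn m (unbump i j)).
Proof. by rewrite -ltnS => jm; rewrite (vtx_act _ _ (Ordinal jm)). Qed.

Lemma vtx_homo m (x : B m) i j : i <= j -> j <= m -> vtx x i <= vtx x j.
Proof. by move=> ij jm; apply: op_homo; rewrite !inordK //; lia. Qed.

Lemma vtx_bound m (x : B m) j : vtx x j <= n.
Proof. by rewrite -ltnS ltn_ord. Qed.

(** The vertices of x below k come first: [kpos x] counts them, and it is the
    index of the first k-vertex if there is one, and otherwise the place where a
    k-vertex can be inserted. *)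
Definition kpos m (x : B m) : nat := find (fun j => k <= vtx x j) (iota 0 m.+1).

Lemma kpos_bound m (x : B m) : kpos x <= m.+1.
Proof. by rewrite -[X in _ <= X](size_iota 0) find_size. Qed.

Lemma kposP m (x : B m) j : j <= m -> (vtx x j < k) = (j < kpos x).
Proof.
move=> jm; case: (ltnP j (kpos x)) => [|H].
  rewrite /kpos => jp; have := before_find 0 jp.
  by rewrite nth_iota ?add0n; lia.
apply/negbTE; rewrite -leqNgt.
have pm : kpos x <= m by lia.
have : has (fun j => k <= vtx x j) (iota 0 m.+1).
  by rewrite has_find size_iota.
move/(nth_find 0); rewrite -/(kpos x) nth_iota // add0n => kp.
exact: leq_trans kp (vtx_homo x H jm).
Qed.

Lemma kpos_uniq m (x : B m) q : q <= m.+1 ->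
  (forall j, j <= m -> (vtx x j < k) = (j < q)) -> kpos x = q.
Proof.
move=> qm xq; have := kpos_bound x; case: (ltngtP (kpos x) q) => // [pq|qp] pm.
- have := xq (kpos x) ltac:(lia); rewrite kposP; lia.
- have := xq q ltac:(lia); rewrite kposP; lia.
Qed.

Lemma kpos_face m i (x : B m.+1) : i <= m.+1 ->
  kpos (face i x) = unbump i (kpos x).
Proof.
move=> im; have pm := kpos_bound x; apply: kpos_uniq => [|j jm].
  by rewrite /unbump; lia.
by rewrite vtx_face // kposP /bump /unbump; lia.
Qed.

Lemma kpos_degen m i (x : B m) : i <= m ->
  kpos (degen i x) = (i < kpos x) + kpos x.
Proof.
move=> im; have pm := kpos_bound x; apply: kpos_uniq => [|j jm]; first by lia.
by rewrite vtx_degen // kposP /unbump; lia.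
Qed.

(** The condition for x to have a cone. A cone on a simplex over the vertex k
    alone would have all its faces prescribed, and could not be obtained by
    filling. *)
Definition offk m (x : B m) := exists2 j, j <= m & vtx x j != k.

Lemma offk_degen m i (x : B m) : i <= m -> offk (degen i x) <-> offk x.
Proof.
move=> im; split=> -[j jm xj].
  by exists (minn m (unbump i j)); [lia | rewrite -vtx_degen].
exists (bump i j); first by rewrite /bump; lia.
rewrite vtx_degen; last by rewrite /bump; lia.
suff -> : minn m (unbump i (bump i j)) = j by [].
by rewrite bumpK; lia.
Qed.

Lemma offk_face m i (x : B m.+1) : i <= m.+1 -> vtx x i = k ->
  offk x -> offk (face i x).
Proof.
move=> im xi [j jm xj]; have ij : j != i by apply: contraNneq xj => ->; apply/eqP.
exists (unbump i j); first by rewrite /unbump; lia.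
by rewrite vtx_face ?unbumpK //; rewrite /unbump; lia.
Qed.

Lemma vtx_degen_eq m i (x : B m) : i <= m ->
  vtx (degen i x) i = vtx (degen i x) i.+1.
Proof.
by move=> im; rewrite !vtx_degen; [congr vtx; rewrite /unbump; lia|lia..].
Qed.

Definition is_cone m (x : B m) (y : B m.+1) :=
  vtx y (kpos x) = k /\ face (kpos x) y = x.

Section IsCone.
Variables (m : nat) (x : B m) (y : B m.+1).
Hypothesis xy : is_cone x y.

Lemma cone_vtx j : j <= m -> vtx y (bump (kpos x) j) = vtx x j.
Proof. by case: xy => [_ {2}<-] jm; rewrite vtx_face. Qed.

Lemma cone_vtxS j : kpos x <= j -> j <= m -> vtx y j.+1 = vtx x j.
Proof. by move=> pj jm; rewrite -cone_vtx // /bump pj. Qed.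

Lemma cone_vtx_lt j : j < kpos x -> j <= m -> vtx y j = vtx x j.
Proof. by move=> jp jm; rewrite -(cone_vtx jm) /bump leqNgt jp. Qed.

Lemma kpos_cone : kpos y = kpos x.
Proof.
have pm := kpos_bound x; apply: kpos_uniq => [|j jm]; first by lia.
have [jp|pj|->] := ltngtP j (kpos x).
- by rewrite cone_vtx_lt ?kposP; lia.
- case: j pj jm => // j pj jm; rewrite cone_vtxS ?kposP; lia.
- by case: xy => -> _; rewrite ltnn.
Qed.

Lemma offk_cone : offk x -> offk y.
Proof.
case=> j jm xj; exists (bump (kpos x) j); first by rewrite /bump; lia.
by rewrite cone_vtx.
Qed.
End IsCone.

(** What the cones C in dimension m must satisfy for them to extend to
    dimension m+1. Apart from [coh_cone], these are consequences of the
    relations [cone_step] with dimension m-1; stating them without reference to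
    the cones in dimension m-1 lets the induction start at m = 0. A simplex u
    with [C u = degen (kpos u) u] is one that behaves like a cone. *)
Record coherent m (C : B m -> B m.+1) : Prop := Coherent {
  coh_cone : forall x, offk x -> is_cone x (C x);
  coh_face : forall y j, offk y -> j <= m -> vtx y j = k ->
    C (face j.+1 (C y)) = degen (kpos (face j.+1 (C y))) (face j.+1 (C y));
  coh_degen : forall y u i, offk y -> i <= m -> C y = degen i u ->
    C u = degen (kpos u) u;
  coh_degen_eq : forall u v i j, offk u -> i < j -> j <= m ->
    degen i u = degen j v ->
    degen (bump (kpos u) i) (C u) = degen (bump (kpos v) j) (C v);
  coh_face_degen : forall u i j, offk u -> i <= m -> j <= m.+1 ->
    vtx (degen i u) j = k ->
    j <> i -> j <> i.+1 ->
    face j.+1 (degen (bump (kpos u) i) (C u)) = C (face j (degen i u));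
  coh_face_face : forall (x : B m.+1) i j, offk x -> i < j -> j <= m.+1 ->
    vtx x i = k -> vtx x j = k ->
    face j (C (face i x)) = face i.+1 (C (face j x)) }.

(** Up to the shift of indices by the new vertex, the cones in two consecutive
    dimensions commute with the faces at k-vertices and with all degeneracies,
    and the cone on a cone is degenerate: they form an extra degeneracy. *)
Record cone_step m (C : B m -> B m.+1) (C' : B m.+1 -> B m.+2) : Prop :=
    ConeStep {
  step_face : forall x j, offk x -> j <= m.+1 -> vtx x j = k ->
    face j.+1 (C' x) = C (face j x);
  step_degen : forall u i, offk u -> i <= m ->
    C' (degen i u) = degen (bump (kpos u) i) (C u);
  step_cone : forall y, offk y -> C' (C y) = degen (kpos y) (C y) }.

(** In dimension 0 the conditions are vacuous: a point satisfying [offk] has no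
    k-vertex, its cone is an edge whose endpoints lie over different vertices and
    so is not degenerate, and two distinct degeneracies or two distinct k-vertices
    are not available. *)
Lemma coherent0 (C : B 0 -> B 1) :
  (forall x, offk x -> is_cone x (C x)) -> coherent C.
Proof.
have Q0 (y : B 0) : offk y -> vtx y 0 != k.
  by case=> j; rewrite leqn0 => /eqP ->.
move=> HC; split=> //; try by lia.
- move=> y j /Q0/eqP yk; rewrite leqn0 => /eqP -> //.
- move=> y u [|//] Qy _ E; have [yk _] := HC y Qy.
  have := cone_vtx (HC y Qy) (leqnn 0); have := vtx_degen_eq u (leqnn 0).
  have /eqP := Q0 y Qy; have := kpos_bound y; rewrite -E /bump; move: yk.
  by case: (kpos y) => [|[|//]] /=; rewrite ?addn0; congruence.
- move=> x [|i] [|[|j]] // [[|[|l]] // _ /eqP xl] _ _ *; congruence.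
Qed.

(** Each condition results from simplicial identities. For [coh_degen], if the
    cone on y is [degen i u], then either the degeneracy does not involve the
    new vertex, so it comes from y and u is the cone on a face of u; or it
    repeats the new vertex (i = [kpos y]), and then u = y is a face of its own
    cone at a k-vertex, hence a cone. The degeneracy with i+1 = [kpos y] is
    impossible as it would identify a vertex below k with one over k. *)
Lemma coherent_step m (C : B m -> B m.+1) (C' : B m.+1 -> B m.+2) :
  coherent C ->
  (forall x, offk x -> is_cone x (C' x)) -> cone_step C C' -> coherent C'.
Proof.
move=> gC HC' [a b c]; have HC := coh_cone gC; split=> //.
- move=> y j Qy jm yj; rewrite a //.
  have Qz := offk_face jm yj Qy; have cz := HC _ Qz.
  by rewrite c // (kpos_cone cz).
- move=> y u i Qy im E; have cy := HC' _ Qy; have py := kpos_cone cy.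
  have Pm := kpos_bound y; set P := kpos y in py Pm.
  have pE : P = (i < kpos u) + kpos u by rewrite -kpos_degen // -E.
  have yE : y = face P (degen i u) by rewrite -E (proj2 cy).
  have [iP|Pi|iP] := ltngtP i P.
  + have iP1 : i.+1 <> P.
      move=> iP1; have := vtx_degen_eq u im; rewrite -E iP1 (proj1 cy) => ik.
      by have := @kposP _ (C' y) i ltac:(lia); rewrite py ik ltnn iP.
    have P1 : P = P.-1.+1 by lia.
    have {}yE : y = degen i (face P.-1 u) by rewrite yE P1 face_degen_gt; try lia.
    have Qd : offk (face P.-1 u) by apply/(@offk_degen _ i); [lia|rewrite -yE].
    have pd : kpos (face P.-1 u) = kpos u by rewrite kpos_face /unbump; lia.
    have uE : u = C (face P.-1 u).
      rewrite -[LHS](face_degen _ im) -E {1}yE b //; last lia.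
      have -> : bump (kpos (face P.-1 u)) i = i by ulia.
      by rewrite face_degen.
    by rewrite {1}uE c // pd -uE.
  + have {}yE : y = degen i.-1 (face P u) by rewrite yE -{1}(ltn_predK Pi) face_degen_lt //; lia.
    have Qd : offk (face P u) by apply/(@offk_degen _ i.-1); [lia|rewrite -yE].
    have pd : kpos (face P u) = kpos u by rewrite kpos_face /unbump; lia.
    have uE : u = C (face P u).
      rewrite -[LHS](face_degen _ im) -E {1}yE b //; last lia.
      have -> : bump (kpos (face P u)) i.-1 = i by ulia.
      by rewrite face_degen.
    by rewrite {1}uE c // pd -uE.
  + have {}yE : u = y by rewrite yE -iP face_degen.
    have yi : vtx y i = k.
      rewrite -(cone_vtxS cy); [|lia..].
      by rewrite E -vtx_degen_eq // -E iP; case: cy.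
    have uE : y = C (face i y) by rewrite -a // E faceS_degen.
    rewrite yE {1}uE c //; last exact: offk_face.
    by rewrite -uE kpos_face //; congr degen; ulia.
- move=> u v i j Qu ij jm E; set w := face i v.
  have uE : u = degen j.-1 w.
    by rewrite -[LHS](@face_degen _ _ i) ?E -1?{1}(ltn_predK ij) ?face_degen_lt //; lia.
  have vE : v = degen i w.
    rewrite -[LHS](faceS_degen _ jm) -E face_degen_gt //.
    by rewrite uE -{1}(ltn_predK ij) faceS_degen //; lia.
  have Qw : offk w by apply/(@offk_degen _ j.-1); [lia|rewrite -uE].
  have pw := kpos_bound w.
  rewrite uE vE !kpos_degen ?b //; try lia.
  rewrite degen_degen; [|ulia..].
  by congr (degen _ (degen _ _)); ulia.
- move=> u i j Qu im jm uj ji jiS.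
  have jp : kpos (degen i u) <= j by rewrite leqNgt -kposP // uj ltnn.
  rewrite kpos_degen // in jp.
  have [ij|ij] := leqP i j.
    have uj1 : vtx u j.-1 = k.
      by rewrite -uj vtx_degen //; congr vtx; ulia.
    have pj : kpos u <= j.-1 by rewrite leqNgt -kposP ?uj1 ?ltnn; lia.
    have jE : j = j.-1.+1 by lia.
    have Qd : offk (face j.-1 u) by apply: offk_face => //; lia.
    have pd : kpos (face j.-1 u) = kpos u by rewrite kpos_face; ulia.
    rewrite face_degen_gt; [|ulia..].
    rewrite {1}jE a //; last lia.
    rewrite {2}jE face_degen_gt ?b ?pd //; lia.
  have uj1 : vtx u j = k by rewrite -uj vtx_degen //; congr vtx; ulia.
  have Qd : offk (face j u) by apply: offk_face => //; lia.
  have iE : i = i.-1.+1 by lia.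
  have pd : kpos (face j u) = kpos u by rewrite kpos_face; ulia.
  have -> : bump (kpos u) i = i.+1 by ulia.
  rewrite face_degen_lt ?a //; try lia.
  rewrite {2}iE face_degen_lt ?b ?pd //; try lia.
  by congr degen; ulia.
- move=> x i j Qx ij jm xi xj.
  have jE : j = j.-1.+1 by lia.
  have dij : face i (face j x) = face j.-1 (face i x) by rewrite {1}jE face_face //; lia.
  rewrite {1}jE !a ?dij //; try lia.
  + by apply: offk_face => //; lia.
  + by rewrite vtx_face -1?xi; [congr vtx; ulia|lia].
  + by apply: offk_face => //; lia.
  + by rewrite vtx_face -1?xj; [congr vtx; ulia|lia].
Qed.

Section FillCone.
Hypothesis hf : is_fibration f.

(** The image of a cone on x in the base, as a sequence of vertices. *)
Definition insert_k m (x : B m) j :=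
  if j < kpos x then vtx x j else if j == kpos x then k : nat else vtx x j.-1.

Fact insert_k_bound m (x : B m) j : j <= m.+1 -> insert_k x j <= n.
Proof.
by move=> _; rewrite /insert_k; do 2?case: ifP => _; rewrite ?vtx_bound // -ltnS.
Qed.

Fact insert_k_homo m (x : B m) i j : i <= j -> j <= m.+1 ->
  insert_k x i <= insert_k x j.
Proof.
move=> ij jm; rewrite /insert_k; have pm := kpos_bound x.
have lt_k l : l < kpos x -> vtx x l < k by move=> lp; rewrite kposP //; lia.
have ge_k l : kpos x <= l -> l <= m -> k <= vtx x l.
  by move=> lp lm; rewrite leqNgt kposP //; lia.
case: (ltngtP j (kpos x)) => jp; case: (ltngtP i (kpos x)) => ip; try lia.
- by apply: vtx_homo; lia.
- apply: (@leq_trans k); first exact/ltnW/lt_k.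
  by apply: ge_k; lia.
- by apply: vtx_homo; lia.
- by apply: ge_k; lia.
- exact/ltnW/lt_k.
Qed.

Definition insert_k_op m (x : B m) : opmap m.+1 n :=
  mk_op (@insert_k_bound m x) (@insert_k_homo m x).

Lemma cone_insert_k m (x : B m) y j : is_cone x y -> j <= m.+1 ->
  vtx y j = insert_k x j.
Proof.
move=> xy jm; rewrite /insert_k; have pm := kpos_bound x.
case: (ltngtP j (kpos x)) => jp; first by rewrite (cone_vtx_lt xy) //; lia.
  by case: j jp jm => // j jp jm; rewrite (cone_vtxS xy).
by case: xy; rewrite jp.
Qed.

(** A cone on x whose faces at the old k-vertices are given: these faces and x
    form a proper set of faces, since the ones at the vertices off k are not
    among them. The vertex i of the cone, for [i > kpos x], comes from the vertex
    [i.-1] of x, whence the shifts. *)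
Lemma fill_cone m (x : B m) (F : nat -> B m) : offk x ->
  let I := [set i : 'I_m.+2 |
    (i == kpos x :> nat) || (kpos x < i) && (vtx x i.-1 == k)] in
  let y (i : 'I_m.+2) := if i == kpos x :> nat then x else F i.-1 in
  compatible I y ->
  (forall i l, i <= m -> vtx x i = k -> l <= m ->
     vtx (F i) l = insert_k x (bump i.+1 l)) ->
  exists z, is_cone x z /\ forall i, i <= m -> vtx x i = k -> face i.+1 z = F i.
Proof.
move=> Qx I y cy vF; have pm := kpos_bound x.
have pI : inord (kpos x) \in I by rewrite !inE inordK ?eqxx.
have [||i iI|z [fz yz]] := fill_faces hf (v := insert_k_op x : simplex n m.+1) _ _ cy.
- by apply/finset.set0Pn; exists (inord (kpos x)).
- case: Qx => j jm xj; apply/neq_setTP; exists (inord (bump (kpos x) j)).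
  rewrite !inE inordK; last by ulia.
  rewrite eq_sym (negbTE (neq_bump _ _)) /= negb_and.
  have [pj|jp] := leqP (kpos x) j; last by apply/orP; left; ulia.
  by apply/orP; right; rewrite /bump pj.
- apply: op_ext => l; rewrite /= -[X in f m _ X]inord_val -/(vtx _ _).
  have lm := ltn_ord l.
  move: iI; rewrite inE /y; case: eqP => [-> _|_ /= /andP[pi /eqP xi]].
    rewrite /insert_k /bump; case: (ltngtP l (kpos x)) => lp; rewrite ?add0n ?add1n /=.
    + by rewrite lp.
    + have -> : l.+1 < kpos x = false by lia.
      by have -> : l.+1 == kpos x = false by lia.
    + have -> : l.+1 < kpos x = false by lia.
      by have -> : l.+1 == kpos x = false by lia.
  have im := ltn_ord i; rewrite vF //; try lia.
  by congr (insert_k x (bump _ _)); lia.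
have zE j : j <= m.+1 -> vtx z j = insert_k x j.
  by rewrite /vtx fz => jm /=; rewrite inordK.
exists z; split; first split.
- by rewrite zE // /insert_k ltnn eqxx.
- by have := yz _ pI; rewrite /y inordK // eqxx.
- move=> i im xi; have ipx : kpos x <= i by rewrite leqNgt -kposP // xi ltnn.
  have iI : inord i.+1 \in I.
    by rewrite !inE inordK ?xi ?eqxx ?andbT //=; apply/orP; right.
  have := yz _ iI; rewrite /y inordK // => ->.
  by have -> : i.+1 == kpos x = false by lia.
Qed.

Lemma cone0 (x : B 0) : offk x -> exists y, is_cone x y.
Proof.
move=> Qx; have xk i : i <= 0 -> vtx x i = k -> False.
  by case: Qx => j; rewrite !leqn0 => /eqP -> /eqP xj /eqP ->.
have [||z [cz _]] := @fill_cone 0 x (fun=> x) Qx.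
- move=> i j; rewrite !inE => iI jI r a b.
  have E (l : 'I_2) : (l == kpos x :> nat) || (kpos x < l) && (vtx x l.-1 == k) ->
      l = kpos x :> nat.
    case/orP => [/eqP //|/andP[_ /eqP]] /xk []; by case: l => -[|[]].
  have -> : i = j by apply: val_inj; rewrite /= (E _ iI) (E _ jI).
  by move=> /coface_mono ->; case: ifP.
- by move=> i l /xk xi /xi.
- by exists z.
Qed.

(** If x is a cone or degenerate, the relations dictate its cone, and the
    coherence conditions say that the prescriptions agree with each other.
    Otherwise only the faces are prescribed and the cone is a filler. *)
Lemma coneS m (C : B m -> B m.+1) (x : B m.+1) : coherent C -> offk x ->
  exists y, [/\ is_cone x y,
   forall j, j <= m.+1 -> vtx x j = k -> face j.+1 y = C (face j x),
   forall u i, i <= m -> x = degen i u -> y = degen (bump (kpos u) i) (C u) &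
   forall u, offk u -> x = C u -> y = degen (kpos x) x].
Proof.
move=> gC Qx; have HC := coh_cone gC; have pm := kpos_bound x.
have kp j : j <= m.+1 -> vtx x j = k -> kpos x <= j.
  by move=> jm xj; rewrite leqNgt -kposP // xj ltnn.
have [[w [Qw xw]]|ncone] := pselect (exists w, offk w /\ x = C w).
  have cw := HC _ Qw; have pw := kpos_bound w.
  have px : kpos x = kpos w by rewrite xw (kpos_cone cw).
  exists (degen (kpos x) x); split=> //.
  - split; last by rewrite face_degen //; lia.
    rewrite vtx_degen; last lia.
    have -> : minn m.+1 (unbump (kpos x) (kpos x)) = kpos x by ulia.
    by rewrite px xw; case: cw.
  - move=> j jm xj; have := kp j jm xj; rewrite leq_eqVlt => /predU1P[jp|pj].
      by rewrite -jp faceS_degen ?px; [have := proj2 cw; rewrite -xw => ->|rewrite -px jp].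
    rewrite face_degen_gt //.
    have jE : j = j.-1.+1 by lia.
    have wj : vtx w j.-1 = k by rewrite -(cone_vtxS cw) -?jE -?xw //; lia.
    have := coh_face gC Qw (j := j.-1) ltac:(lia) wj; rewrite -jE -xw => ->.
    by congr (degen _ _); rewrite kpos_face //; ulia.
  - move=> u i im xu; have Qu : offk u by apply/(@offk_degen _ i); rewrite -?xu.
    rewrite (@coh_degen _ _ gC w u i) // -?xw //.
    have := kpos_degen u im; rewrite -xu px => pu.
    rewrite xu pu.
    have [iu|ui] := ltnP i (kpos u).
      by rewrite [RHS]degen_degen; [congr (degen _ (degen _ _)); ulia|ulia..].
    by rewrite degen_degen; [congr (degen _ (degen _ _)); ulia|ulia..].
have {}ncone u : offk u -> x = C u -> False by move=> Qu xu; apply: ncone; exists u.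
have [[u [i [im xu]]]|ndeg] := pselect (exists u i, i <= m /\ x = degen i u).
  have Qu : offk u by apply/(@offk_degen _ i); rewrite -?xu.
  have cu := HC _ Qu; have pu := kpos_bound u.
  have px : kpos x = (i < kpos u) + kpos u by rewrite xu kpos_degen.
  exists (degen (bump (kpos u) i) (C u)); split=> //; last by move=> v /ncone xv /xv.
  - split.
      rewrite vtx_degen; last lia.
      rewrite -[RHS](proj1 cu); congr vtx; ulia.
    rewrite px xu; have [iu|ui] := ltnP i (kpos u).
      have -> : bump (kpos u) i = i by ulia.
      by rewrite add1n face_degen_gt //; case: cu => _ ->.
    have -> : bump (kpos u) i = i.+1 by ulia.
    by rewrite add0n face_degen_lt //; case: cu => _ ->.
  - move=> j jm xj; have pj := kp j jm xj.
    have [ji|ji] := eqVneq j i.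
      have -> : bump (kpos u) i = i.+1 by ulia.
      by rewrite xu ji !face_degen.
    have [jiS|jiS] := eqVneq j i.+1.
      have -> : bump (kpos u) i = i.+1 by ulia.
      by rewrite xu jiS !faceS_degen.
    rewrite xu (coh_face_degen gC) -?xu //; exact/eqP.
  - move=> v j jm xv; have Qv : offk v by apply/(@offk_degen _ j); rewrite -?xv.
    have [ij|ji|ij] := ltngtP i j.
    + by apply: (coh_degen_eq gC); rewrite -?xv.
    + by apply/esym/(coh_degen_eq gC); rewrite -?xv.
    + by have := congr1 (face i) xv; rewrite xu ij !face_degen // => ->.
have {}ndeg u i : i <= m -> x = degen i u -> False.
  by move=> im xu; apply: ndeg; exists u, i.
have cd i : i <= m.+1 -> vtx x i = k -> is_cone (face i x) (C (face i x)).
  by move=> im xi; apply/HC/offk_face.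
have pd i : i <= m.+1 -> vtx x i = k -> kpos (face i x) = kpos x.
  by move=> im xi; rewrite kpos_face // /unbump; have := kp i im xi; lia.
have [||z [cz dz]] := @fill_cone _ x (fun i => C (face i x)) Qx.
- apply: compatible_faces => i j; rewrite !inE => iI jI ij.
  have pi : kpos x <= i by case/orP: iI => [/eqP->|/andP[/ltnW]].
  have jp : (j == kpos x :> nat) = false by lia.
  have im := ltn_ord i; have jm := ltn_ord j.
  move: jI; rewrite jp /= => /andP[pj /eqP xj].
  have jm' : j.-1 <= m.+1 by lia.
  case: eqP iI => [ip _|ip /= /andP[p_i /eqP xi]].
    by rewrite ip -(pd j.-1) //; case: (cd _ jm' xj).
  have := coh_face_face gC Qx (i := i.-1) (j := j.-1) ltac:(lia) jm' xi xj => ->.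
  by congr face; lia.
- move=> i l im xi lm; rewrite (cone_insert_k (cd i im xi)) // /insert_k pd //.
  have pi := kp i im xi.
  case: (ltngtP l (kpos x)) => lp.
  + have -> : bump i.+1 l = l by ulia.
    by rewrite lp vtx_face; [congr vtx; ulia|lia].
  + have -> : bump i.+1 l < kpos x = false by ulia.
    have -> : bump i.+1 l == kpos x = false by ulia.
    by rewrite vtx_face; [congr vtx; ulia|lia].
  + have -> : bump i.+1 l = kpos x by ulia.
    by rewrite ltnn eqxx.
exists z; split=> //.
- by move=> u i /ndeg xu /xu.
- by move=> u /ncone xu /xu.
Qed.

Lemma exists_cone_fun m (P : B m -> B m.+1 -> Prop) :
  (forall x, offk x -> exists y, P x y) ->
  exists C : B m -> B m.+1, forall x, offk x -> P x (C x).
Proof.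
move=> H; have {}H x : exists y, offk x -> P x y.
  have [/H[y Py]|nQ] := pselect (offk x); first by exists y.
  by exists (degen 0 x).
by exists (fun x => sval (cid (H x))) => x; case: cid.
Qed.

Lemma exists_cone_step m (C : B m -> B m.+1) : coherent C ->
  exists C', cone_step C C' /\ coherent C'.
Proof.
move=> gC; have [C' HC'] := exists_cone_fun (fun x => coneS (x := x) gC).
exists C'; have st : cone_step C C'.
  split.
  - by move=> x j Qx; have [_ H _ _] := HC' x Qx; apply: H.
  - move=> u i Qu im; have [_ _ H _] := HC' (degen i u) (proj2 (offk_degen u im) Qu).
    exact: H im erefl.
  - move=> y Qy; have cy := coh_cone gC Qy; have [_ _ _ H] := HC' (C y) (offk_cone cy Qy).
    by rewrite (H _ Qy erefl) (kpos_cone cy).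
by split=> //; apply: coherent_step gC _ st => x Qx; have [] := HC' x Qx.
Qed.

Lemma exists_cone : exists C : forall m, B m -> B m.+1,
  (forall m (x : B m), offk x -> is_cone x (C m x)) /\
  forall m, cone_step (C m) (C m.+1).
Proof.
pose T m := {C : B m -> B m.+1 | coherent C}.
have [C0 HC0] := exists_cone_fun cone0.
pose t0 : T 0 := exist _ C0 (coherent0 HC0).
have tS m (t : T m) : exists t' : T m.+1, cone_step (sval t) (sval t').
  by have [C' [st gC']] := exists_cone_step (svalP t); exists (exist _ C' gC').
pose t := fix t m : T m := if m is m'.+1 then sval (cid (tS m' (t m'))) else t0.
exists (fun m => sval (t m)); split=> [m|m].
  exact: coh_cone (svalP (t m)).
by rewrite /=; case: cid.
Qed.

End FillCone.
End Cone.

(** * Nondegenerate simplices *)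

Definition op_surj m r (g : opmap m r) := forall j, exists i, g i = j.

Lemma exists_op m r (e : 'I_m.+1 -> 'I_r.+1) :
  (forall i j : 'I_m.+1, i <= j -> e i <= e j) ->
  exists g : opmap m r, forall i, g i = e i.
Proof.
move=> he; pose h j : nat := e (inord j).
have hb j : j <= m -> h j <= r by move=> _; exact: (ltn_ord (e (inord j))).
have hh i j : i <= j -> j <= m -> h i <= h j.
  by move=> ij jm; apply: he; rewrite !inordK //; lia.
by exists (mk_op hb hh) => i; apply: val_inj; rewrite /= /h inord_val.
Qed.

(** A monotone map factors through t as soon as it does pointwise: any choice of
    preimages that depends only on the value is monotone. One preimage can be
    imposed, which is used to compare two surjections via their sections. *)
Lemma op_lift m q r (t : opmap m q) (g : opmap r q) (i0 : 'I_m.+1) :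
  (forall l, exists i, t i = g l) ->
  exists2 e : opmap r m, op_comp t e = g & forall l, g l = t i0 -> e l = i0.
Proof.
move=> tg; pose c v := if v == t i0 then i0 else odflt i0 [pick i | t i == v].
have tc l : t (c (g l)) = g l.
  rewrite /c; case: eqP => // _; case: pickP => [i /eqP //|].
  by have [i ti] := tg l; move/(_ i); rewrite ti eqxx.
have [|e eE] := @exists_op _ _ (fun l => c (g l)).
  move=> i j ij; have := op_homo g ij; rewrite leq_eqVlt.
  case/predU1P => [/val_inj -> //|gij]; rewrite leqNgt; apply/negP => /ltnW cji.
  by have := op_homo t cji; rewrite !tc leqNgt gij.
exists e; first by apply: opmap_ext => l /=; rewrite eE tc.
by move=> l gl; rewrite eE gl /c eqxx.
Qed.

Lemma op_inj_id m (g : opmap m m) : injective g -> g = op_id m.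
Proof.
move=> gi.
have glt (i j : 'I_m.+1) : i < j -> g i < g j.
  move=> ij; rewrite ltn_neqAle op_homo ?(ltnW ij) // andbT.
  by apply: contraTneq ij => /val_inj/gi ->; rewrite ltnn.
have ge t : forall i : 'I_m.+1, t <= i -> t <= g i.
  elim: t => // t IH i ti; have tm : t < m.+1 by have := ltn_ord i; lia.
  have := IH (Ordinal tm) (leqnn t).
  by have := glt (Ordinal tm) i ti; lia.
have le t : forall i : 'I_m.+1, t <= m - i -> t <= m - g i.
  elim: t => // t IH i ti; have tm : i.+1 < m.+1 by have := ltn_ord i; lia.
  have := IH (Ordinal tm) ltac:(move=> /=; lia).
  by have := glt i (Ordinal tm) (ltnSn i); have := ltn_ord (g (Ordinal tm)); lia.
apply: op_ext => i /=; have := ge _ i (leqnn _); have := le _ i (leqnn _).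
by have := ltn_ord i; have := ltn_ord (g i); lia.
Qed.

Section Nondegenerate.
Variable X : sset.

(** Equivalent to not being a degeneracy, by [nondegPn] and
    [degen_not_nondeg]; in this form it applies to all operators at once. *)
Definition nondeg m (x : X m) :=
  forall r (z : X r) (g : opmap m r), x = act g z -> injective g.

Lemma nondeg0 (x : X 0) : nondeg x.
Proof. by move=> r z g _ i j _; rewrite !ord1. Qed.

(** A monotone map that is not injective identifies two consecutive elements i
    and i+1, so it does not change when composed with the idempotent that sends
    i+1 to i. *)
Lemma nondegPn m (x : X m.+1) : ~ nondeg x ->
  exists2 i, i <= m & x = degen i (face i.+1 x).
Proof.
move=> ndx; apply: contrapT => H; apply: ndx => r z g xE.
suff glt (i j : 'I_m.+2) : i < j -> g i <> g j.
  move=> i j gij; apply/val_inj; apply: contrapT => /eqP.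
  by case: ltngtP => // /glt []; rewrite gij.
move=> ij gij; apply: H; have im : i <= m by have := ltn_ord j; lia.
exists (i : nat) => //; rewrite xE /degen /face -!act_comp; congr act.
apply: opmap_ext => l /=.
have [lj|lj] := eqVneq (l : nat) i.+1; last first.
  by congr (g _); apply: val_inj => /=; have := ltn_ord l; rewrite /bump /unbump; lia.
apply: val_inj; apply/eqP; rewrite eqn_leq; apply/andP; split; last first.
  by apply: op_homo => /=; have := ltn_ord l; rewrite /bump /unbump; lia.
apply: leq_trans (_ : g j <= _); first by apply: op_homo; lia.
rewrite -gij; apply: op_homo => /=; have := ltn_ord l.
rewrite /bump /unbump; lia.
Qed.

Lemma degen_not_nondeg m i (u : X m) : i <= m -> ~ nondeg (degen i u).
Proof.
move=> im /(_ _ u (codegen m i) erefl).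
move=> /(_ (Ordinal (_ : i < m.+2)) (Ordinal (_ : i.+1 < m.+2))).
move=> /(_ ltac:(lia) ltac:(lia)) H.
have /(congr1 val)/= := H ltac:(apply: val_inj => /=; rewrite /unbump; lia).
lia.
Qed.

(** The uniqueness part of the Eilenberg-Zilber lemma. Composing with a section
    of g presents u as obtained from v by an operator, which has to be injective;
    this compares the dimensions, and when they are equal the operator is the
    identity, for every section of g. *)
Lemma EZ_le m a b (u : X a) (v : X b) (g : opmap m a) (h : opmap m b) :
  nondeg u -> op_surj g -> act g u = act h v -> a <= b.
Proof.
move=> nu gs uv; have [e ge _] := @op_lift _ _ _ g (op_id a) ord0 gs.
have uE : u = act (op_comp h e) v by rewrite act_comp -uv -act_comp ge act_id.
by have := leq_card _ (nu _ _ _ uE); rewrite !card_ord.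
Qed.

Lemma EZ_dim m a b (u : X a) (v : X b) (g : opmap m a) (h : opmap m b) :
  nondeg u -> nondeg v -> op_surj g -> op_surj h -> act g u = act h v -> a = b.
Proof.
move=> nu nv gs hs uv; apply/eqP; rewrite eqn_leq.
by rewrite (EZ_le nu gs uv) (EZ_le nv hs (esym uv)).
Qed.

Lemma EZ_uniq m a (u v : X a) (g h : opmap m a) :
  nondeg u -> op_surj g -> act g u = act h v -> u = v /\ g = h.
Proof.
move=> nu gs uv.
have key i0 : exists2 e, op_comp h e = op_id a /\ u = v & e (g i0) = i0.
  have [e ge ei] := @op_lift _ _ _ g (op_id a) i0 gs.
  have uE : u = act (op_comp h e) v by rewrite act_comp -uv -act_comp ge act_id.
  have he := op_inj_id (nu _ _ _ uE).
  by exists e; [rewrite {1}he uE he act_id | apply: ei].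
have [e0 [_ uv0] _] := key ord0; split=> //.
apply: opmap_ext => i; have [e [he _] ei] := key i.
by have := congr1 (fun u : opmap _ _ => u (g i)) he => /= <-; rewrite ei.
Qed.
End Nondegenerate.

(** * Attaching cells along horns *)

(** The hypotheses say that in each dimension the simplices of G outside F are in
    bijection with those of the disjoint union of the standard simplices outside
    their horns, which is what a pushout along a monomorphism of sets amounts
    to. *)
Lemma horn_attachment (X : sset) (F G : subcomplex X) (FG : sub_le F G)
  (J : Type) (dim : J -> nat) (k : forall j, 'I_(dim j).+1)
  (c : forall j, X (dim j)) :
  (forall j, 0 < dim j) ->
  (forall j, G _ (c j)) ->
  (forall j r (t : opmap r (dim j)), F _ (act t (c j)) <-> horn (k j) r t) ->
  (forall r (z : X r), G r z -> F r z \/ exists j t, z = act t (c j)) ->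
  (forall r j j' (t : opmap r (dim j)) (t' : opmap r (dim j')),
     ~ horn (k j) r t -> ~ horn (k j') r t' -> act t (c j) = act t' (c j') ->
     existT (fun j => opmap r (dim j)) j t = existT _ j' t') ->
  is_pushout_of_horns (sub_incl FG).
Proof.
move=> dim0 cG cF GF cinj; exists J, dim, k; split=> //.
pose cell r j (t : opmap r (dim j)) : coprod (fun j => simplex (dim j)) r :=
  existT (fun j => simplex (dim j) r) j t.
pose hcell r j (t : sub_sset (horn (k j)) r) :
  coprod (fun j => sub_sset (horn (k j))) r := existT _ j t.
pose uf r (t : coprod (fun j => sub_sset (horn (k j))) r) : sub_sset F r :=
  exist (F r) (act (sval (projT2 t)) (c (projT1 t)))
    (proj2 (cF _ _ _) (svalP (projT2 t))).
have uf_nat r q (h : opmap r q) t : uf r (act h t) = act h (uf q t).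
  by apply: eq_exist; rewrite /= act_comp.
pose vf r (t : coprod (fun j => simplex (dim j)) r) : sub_sset G r :=
  exist (G r) (act (projT2 t : opmap r _) (c (projT1 t)))
    (sub_act (projT2 t : opmap r _) (cG (projT1 t))).
have vf_nat r q (h : opmap r q) t : vf r (act h t) = act h (vf q t).
  by apply: eq_exist; rewrite /= act_comp.
exists (SMap uf_nat), (SMap vf_nat); split.
  by apply: smap_ext => r [j t]; apply: eq_exist.
move=> T a b ab.
have abE r j (t : opmap r (dim j)) (Ft : F r (act t (c j))) :
    a r (exist _ _ Ft) = b r (cell r j t).
  have ht : horn (k j) r t by apply/cF.
  have := congr1 (fun u : smap (coprod _) T =>
    u r (hcell r j (exist (horn (k j) r) t ht))) ab.
  by rewrite /= => <-; congr (a r _); apply: eq_exist.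
have hE r (z : sub_sset G r) : exists y,
    (forall Fz : F r (sval z), y = a r (exist _ _ Fz)) /\
    (forall j t, sval z = act t (c j) -> y = b r (cell r j t)).
  have [Fz|nFz] := pselect (F r (sval z)).
    exists (a r (exist _ _ Fz)); split=> [Fz'|j t zE].
      by congr (a r _); apply: eq_exist.
    by move: Fz; rewrite zE => Fz; apply: abE.
  case: (GF _ _ (svalP z)) => // -[j [t zE]].
  exists (b r (cell r j t)); split=> // j' t' zE'.
  congr (b r _); apply: cinj; rewrite -?zE //.
    by rewrite -cF -zE.
  by rewrite -cF -zE'.
pose h r z := sval (cid (hE r z)).
have hF r z (Fz : F r (sval z)) : h r z = a r (exist _ _ Fz).
  by rewrite /h; case: cid => y [].
have hc r z j t : sval z = act t (c j) -> h r z = b r (cell r j t).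
  by rewrite /h; case: cid => y [? H] /H.
have h_nat r q (g : opmap r q) z : h r (act g z) = act g (h q z).
  case: (GF _ _ (svalP z)) => [Fz|[j [t zE]]].
    rewrite (hF _ z Fz) -smap_nat hF; first exact: (sub_act g Fz).
    by move=> Fgz; congr (a r _); apply: eq_exist.
  rewrite (hc _ _ _ _ zE) -smap_nat; apply: hc => /=.
  by rewrite zE act_comp.
exists (SMap h_nat); split; first split.
- by apply: smap_ext => r [z Fz]; apply: hF.
- by apply: smap_ext => r [j t]; apply: hc.
move=> h' [ha hb]; apply: smap_ext => r [z Gz] /=.
case: (GF _ _ Gz) => [Fz|[j [t zE]]].
  rewrite (hF _ (exist _ z Gz) Fz) -ha /=; congr (h' r _); exact: eq_exist.
rewrite (hc _ (exist _ z Gz) _ _ zE) -hb /=; congr (h' r _).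
by apply: eq_exist; rewrite /= zE.
Qed.

(** * The ordinal omega + 1 *)

Section Omega.
(** [Some t] is the finite ordinal t, and [None] is omega. *)
Definition omega1 := option nat.
HB.instance Definition _ := Choice.on omega1.

Definition omega_le (x y : omega1) : bool :=
  if y is Some b then if x is Some a then a <= b else false else true.

Fact omega_le_refl : reflexive omega_le.
Proof. by case=> /=. Qed.
Fact omega_le_anti : antisymmetric omega_le.
Proof. by case=> [a|] [b|] //= /anti_leq ->. Qed.
Fact omega_le_trans : transitive omega_le.
Proof. by case=> [a|] [b|] [c|] //=; apply: leq_trans. Qed.
Fact omega_le_total : total omega_le.
Proof. by case=> [a|] [b|] //=; apply: leq_total. Qed.

HB.instance Definition _ := Order.Le_isPOrder.Build (Order.Disp tt tt) omega1
  omega_le_refl omega_le_anti omega_le_trans.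
HB.instance Definition _ := Order.POrder_isTotal.Build _ omega1 omega_le_total.

Fact omega_le0 (x : omega1) : (Some 0 <= x :> omega1)%O.
Proof. by case: x. Qed.
Fact omega_le1 (x : omega1) : (x <= None :> omega1)%O.
Proof. by []. Qed.
HB.instance Definition _ := Order.hasBottom.Build _ omega1 omega_le0.
HB.instance Definition _ := Order.hasTop.Build _ omega1 omega_le1.

Lemma omega_wo : well_order (<=%O : rel omega1).
Proof.
apply: antisymmetric_well_order; first exact: omega_le_anti.
move=> A [x Ax].
have [[a Aa]|H] := pselect (exists a : nat, (Some a : omega1) \in A).
  have [b Ab bmin] := ex_minnP (ex_intro (fun a => (Some a : omega1) \in A) a Aa).
  by exists (Some b); split=> // -[c Ac|//]; apply: bmin.
exists x; split=> // y Ay; case: y Ay => [c Ac|//]; first by case: H; exists c.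
Qed.

Lemma omega_ltE (a b : nat) : ((Some a : omega1) < Some b)%O = (a < b).
Proof.
by rewrite Order.POrderTheory.lt_def ltn_neqAle eq_sym.
Qed.

Lemma omega_succ (a b : omega1) : is_succ a b ->
  exists t : nat, a = Some t /\ b = Some t.+1.
Proof.
case: a => [t|] [ab H]; last by case: b ab H.
have tS : ((Some t : omega1) < Some t.+1)%O by rewrite omega_ltE.
have := H _ tS; case: b ab {H} => [c|//].
rewrite omega_ltE => tc.
change (c <= t.+1 ->
  exists t0, Some t = Some t0 /\ Some c = Some t0.+1).
by move=> ct; exists t; split=> //; congr Some; lia.
Qed.

Lemma omega_limit (l : omega1) : is_limit l -> l = None.
Proof.
case: l => [[|t]|//] [l0 H]; first by case: l0.
case: (H (Some t)); split=> [|[c|//]]; first by rewrite omega_ltE.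
by rewrite omega_ltE.
Qed.

End Omega.

(** * The filtration by weight *)

Section Filtration.
Variables (n : nat) (hn : 0 < n) (k : 'I_n.+1).
Variables (B : sset) (f : smap B (simplex n)).
Local Notation vtx := (vtx f).
Local Notation kpos := (kpos k f).
Local Notation offk := (offk k f).
Local Notation is_cone := (is_cone k f).

Definition nonk m (x : B m) : {set 'I_m.+1} := [set j : 'I_m.+1 | vtx x j != k].

(** Inserting a k-vertex raises the weight by 1 and removing a vertex off k
    lowers it by 2, so a face of a cone on x opposite to a vertex off k weighs
    less than x. *)
Definition wt m (x : B m) : nat := m.+1 + #|nonk x|.

Lemma nonk_act m r (g : opmap r m) (x : B m) :
  nonk (act g x) = g @^-1: nonk x.
Proof. by apply/setP => j; rewrite !inE vtx_act. Qed.

Lemma nonk_inj m r (g : opmap r m) (x : B m) : injective g ->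
  #|nonk (act g x)| <= #|nonk x|.
Proof.
move=> gi; rewrite nonk_act -(card_imset _ gi) subset_leq_card //.
by apply/fintype.subsetP => _ /imsetP[j jx ->]; rewrite inE in jx.
Qed.

Lemma coface_inj m i : injective (coface m i).
Proof. by move=> a b /(congr1 val) /(can_inj (bumpK i)) /val_inj. Qed.

Lemma wt_face m i (x : B m.+1) : wt (face i x) < wt x.
Proof.
by have := nonk_inj x (@coface_inj m i); rewrite /wt /face; lia.
Qed.

Lemma wt_face_nonk m i (x : B m.+1) : i <= m.+1 -> vtx x i <> k ->
  (wt (face i x)).+1 < wt x.
Proof.
move=> im xi; suff : #|nonk (face i x)| < #|nonk x| by rewrite /wt; lia.
rewrite /face nonk_act -(card_imset _ (@coface_inj m i)).
apply: proper_card; apply/fintype.properP; split.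
  by apply/fintype.subsetP => _ /imsetP[j jx ->]; rewrite inE in jx.
have iS : i < m.+2 by [].
exists (Ordinal iS); first by rewrite inE; apply/eqP.
apply/negP => /imsetP[j _ /(congr1 val)/= ij].
by have := neq_bump i j; rewrite -ij eqxx.
Qed.

Lemma wt_degen m i (x : B m) : i <= m -> wt x < wt (degen i x).
Proof. by move=> im; rewrite -{1}(face_degen x im) wt_face. Qed.

Lemma nonk_cone m (x : B m) y : is_cone x y -> #|nonk y| <= #|nonk x|.
Proof.
move=> [yk dy]; rewrite -dy /face nonk_act.
rewrite -(card_imset _ (@coface_inj m (kpos x))) subset_leq_card //.
apply/fintype.subsetP => j; rewrite inE => yj; have pm := kpos_bound k f x.
have jp (l : 'I_m.+2) : vtx y l != k -> l <> inord (kpos x).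
  by move=> + lp; rewrite lp inordK ?yk ?eqxx.
have [i iE|] := unliftP (inord (kpos x)) j; last by move/(jp _ yj).
have jE : j = coface m (kpos x) i by rewrite iE; apply: val_inj; rewrite /= inordK.
by apply/imsetP; exists i => //; rewrite !inE -jE.
Qed.

Lemma wt_cone m (x : B m) y : is_cone x y -> wt y <= (wt x).+1.
Proof. by move/nonk_cone; rewrite /wt; lia. Qed.

Definition over_horn m (x : B m) : Prop := horn k m (f m x).

Lemma over_horn_act m r (g : opmap r m) (x : B m) :
  over_horn x -> over_horn (act g x).
Proof. by rewrite /over_horn smap_nat; apply: sub_act. Qed.

Lemma over_hornP m (x : B m) :
  over_horn x <->
  exists i : 'I_n.+1, i <> k /\ forall j, j <= m -> vtx x j <> i.
Proof.
split=> -[i [ik xi]]; exists i; split=> // j.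
  by move=> jm /val_inj; apply: xi.
by move=> xj; apply: (xi j); rewrite -1?ltnS // /vtx inord_val xj.
Qed.

Lemma offk_over_horn m (x : B m) : ~ over_horn x -> offk x.
Proof.
move=> xA; have [i ik] : exists i : 'I_n.+1, i != k.
  have [k0|k0] := eqVneq (k : nat) 0.
    by exists ord_max; rewrite -val_eqE /=; lia.
  by exists ord0; rewrite -val_eqE /=; lia.
apply: contrapT => nQ; apply: xA; apply/over_hornP; exists i; split; first exact/eqP.
move=> j jm xj; apply: nQ; exists j => //; by rewrite xj.
Qed.

Lemma not_over_horn_face m i (x : B m.+1) :
  i <= m.+1 -> vtx x i = k -> ~ over_horn x ->
  ~ over_horn (face i x).
Proof.
move=> im xi xA /over_hornP[l [lk xl]]; apply: xA; apply/over_hornP.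
exists l; split=> // j jm.
have [->|ji] := eqVneq j i; first by rewrite xi => /val_inj/esym.
move=> xj; apply: (xl (unbump i j)); first by ulia.
by rewrite vtx_face ?unbumpK //; ulia.
Qed.

Variable C : forall m, B m -> B m.+1.
Hypothesis C_cone : forall m (x : B m), offk x -> is_cone x (C x).
Hypothesis C_step : forall m, cone_step k f (@C m) (@C m.+1).

Lemma cone_over_horn m (x : B m) : ~ over_horn x -> is_cone x (C x).
Proof. by move=> /offk_over_horn/C_cone. Qed.
Local Hint Resolve cone_over_horn : core.

(** Described by all the cones on simplices of weight less than t, not only
    those on generating simplices: that all these cones are present is then
    immediate, and [stage_succ] recovers the generating ones. *)
Definition stage t m (z : B m) : Prop :=
  over_horn z \/ exists r (x : B r) (g : opmap m r.+1),
    [/\ ~ over_horn x, wt x < t & z = act g (C x)].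

Lemma stage_act t m r (g : opmap r m) (z : B m) :
  stage t z -> stage t (act g z).
Proof.
case=> [zA|[q [x [h [xA xt ->]]]]]; first by left; apply: over_horn_act.
by right; exists q, x, (op_comp h g); rewrite act_comp.
Qed.

Lemma stage_C t m (x : B m) : ~ over_horn x -> wt x < t -> stage t (C x).
Proof. by move=> xA xt; right; exists m, x, (op_id m.+1); rewrite act_id. Qed.

Lemma stage_wt t m (x : B m) : wt x < t -> stage t x.
Proof.
move=> xt; have [|xA] := pselect (over_horn x); first by left.
have [_ <-] := cone_over_horn xA; exact/stage_act/stage_C.
Qed.

Lemma stage_le t u m (x : B m) : t <= u -> stage t x -> stage u x.
Proof.
move=> tu [|[r [y [g [yA yt xE]]]]]; first by left.
by right; exists r, y, g; split=> //; lia.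
Qed.

(** The free faces x of the pairs (x, C x). Being a cone is expressed with
    dependent pairs, because the dimension of x is not known to be positive. *)
Definition generating m (x : B m) : Prop :=
  [/\ nondeg x, ~ over_horn x & forall r (y : B r) , ~ over_horn y ->
     existT (fun m => B m) m x <> existT (fun m => B m) r.+1 (C y)].

Lemma generating_not_cone m (x : B m.+1) y :
  generating x -> ~ over_horn y -> x <> C y.
Proof. by move=> [_ _ H] /H xC xE; apply: xC; rewrite xE. Qed.

(** If x is obtained from a cone on y by an injective operator, then either the
    operator is the identity and x is a cone, or it lowers the weight at least to
    that of y. *)
Lemma generating_stage t m (x : B m) : generating x -> stage t x -> wt x < t.
Proof.
move=> [ndx xA xC] [//|[r [y [g [yA yt xE]]]]].
have gi := ndx _ _ _ xE; have := leq_card _ gi; rewrite !card_ord.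
rewrite ltnS leq_eqVlt => /predU1P[mr|mr].
  subst m; case: (xC _ _ yA); congr existT.
  by rewrite xE (op_inj_id gi) act_id.
have := nonk_cone (cone_over_horn yA); have := nonk_inj (C y) gi.
by rewrite -xE; move: yt; rewrite /wt; lia.
Qed.

(** If x is a cone on y, or a degeneracy of y, then C x is a degeneracy of the
    cone on y, and y weighs less than x. So only the generating simplices
    contribute something new. *)
Lemma stage_succ t m (z : B m) : stage t.+1 z ->
  stage t z \/ exists r (x : B r) (g : opmap m r.+1),
    [/\ generating x, wt x = t & z = act g (C x)].
Proof.
case=> [|[r [x [g [xA xt ->]]]]]; first by left; left.
have [xt'|tx] := ltnP (wt x) t; first by left; apply/stage_act/stage_C.
have {tx}xt : wt x = t by lia.
have [ndx|/contrapT xII] := pselect (~ generating x); last first.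
  by right; exists r, x, g.
left; apply: stage_act.
have [/existsNP[q /existsNP[y /not_implyP[yA /contrapT xy]]]|xC] :=
  pselect (~ forall r' (y : B r'), ~ over_horn y ->
     existT (fun m => B m) r x <> existT (fun m => B m) r'.+1 (C y)).
  have rq := congr1 (@projT1 _ _) xy; rewrite /= in rq; subst r.
  have {}xy : x = C y by apply: eq_from_Tagged xy.
  have cy := cone_over_horn yA.
  rewrite xy (step_cone (C_step q)); last exact: offk_over_horn.
  apply/stage_act/stage_C => //; rewrite -xt xy.
  by case: cy => _ {1}<-; apply: wt_face.
have {}ndx : ~ nondeg x.
  by move=> nd; apply: ndx; split=> //; apply: contrapT xC.
case: r x g xA xt xC ndx => [|r] x g xA xt xC ndx.
  by case: ndx; apply: nondeg0.
have [i ir xE] := nondegPn ndx; set u := face _ x in xE.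
have uA : ~ over_horn u by move=> uA; apply: xA; rewrite xE; apply: over_horn_act.
rewrite xE (step_degen (C_step r)) //; last exact: offk_over_horn.
apply/stage_act/stage_C => //; by rewrite -xt xE wt_degen.
Qed.

(** The ordering of the attachments is well chosen: when the cone on x is to be
    attached, all its faces but x are present. *)
Lemma generating_face m (x : B m) i :
  generating x -> i <= m.+1 -> i <> kpos x ->
  stage (wt x) (face i (C x)).
Proof.
move=> [ndx xA xC] im ip; have cx := cone_over_horn xA.
have [xi|xi] := eqVneq (vtx (C x) i) k; last first.
  apply: stage_wt; have := wt_face_nonk im (elimN eqP xi); have := wt_cone cx; lia.
have pi : kpos x < i.
  rewrite ltn_neqAle eq_sym; apply/andP; split; first exact/eqP.
  by rewrite leqNgt -(kpos_cone cx) -kposP // xi ltnn.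
case: i im ip xi pi => // i im _ xi pi.
have xi' : vtx x i = k by rewrite -(cone_vtxS cx).
case: m x ndx xA xC cx im xi pi xi' => [|m] x ndx xA xC cx im xi pi xi'.
  have [[|//] _] := offk_over_horn xA; move: im xi'; rewrite ltnS leqn0 => /eqP-> ->.
  by rewrite eqxx.
rewrite (step_face (C_step m)) //; last exact: offk_over_horn.
by apply: stage_C (not_over_horn_face _ _ _) (wt_face _ _).
Qed.

(** A degeneracy of the cone not involving the new vertex would make x
    degenerate, and one repeating the new vertex would make x a cone. *)
Lemma generating_nondeg m (x : B m) : generating x -> nondeg (C x).
Proof.
move=> xII; have [ndx xA _] := xII; have cx := cone_over_horn xA.
have pm := kpos_bound k f x.
apply: contrapT => /nondegPn[i im]; set u := face _ _ => E.
have xE : x = face (kpos x) (degen i u) by rewrite -E (proj2 cx).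
have [ip|pi|ip] := ltngtP i (kpos x).
- have ip1 : i.+1 <> kpos x.
    move=> ip1; have := vtx_degen_eq f u im; rewrite -E ip1 (proj1 cx) => ik.
    by have := @kposP _ k _ f _ (C x) i ltac:(lia); rewrite (kpos_cone cx) ik ltnn ip.
  case: m x u xII ndx xA cx pm im E xE ip ip1
    => [|m] x u xII ndx xA cx pm im E xE ip ip1; first by lia.
  have pE : kpos x = (kpos x).-1.+1 by lia.
  move: xE; rewrite pE face_degen_gt; try lia.
  by move=> xE; apply: (@degen_not_nondeg _ m i (face (kpos x).-1 u)); [lia|rewrite -xE].
- case: m x u xII ndx xA cx pm im E xE pi
    => [|m] x u xII ndx xA cx pm im E xE pi; first by lia.
  move: xE; rewrite -{1}(ltn_predK pi) face_degen_lt; try lia.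
  by move=> xE; apply: (@degen_not_nondeg _ m i.-1 (face (kpos x) u)); [lia|rewrite -xE].
- have ux : u = x by rewrite xE -ip face_degen.
  have xi : vtx x i = k.
    rewrite -(cone_vtxS cx) ?ip -1?ip //.
    by rewrite E -vtx_degen_eq // -E ip; case: cx.
  case: m x u xII ndx xA cx pm im E xE ip ux xi
    => [|m] x u xII ndx xA cx pm im E xE ip ux xi.
    have [[|//] _] := offk_over_horn xA; move: im xi; rewrite leqn0 => /eqP-> ->.
    by rewrite eqxx.
  apply: (generating_not_cone xII (not_over_horn_face im xi xA)).
  by rewrite -(step_face (C_step m)) ?E ?faceS_degen //; exact: offk_over_horn.
Qed.

Definition stage_sub t : subcomplex B :=
  Subcomplex (fun m r g x => @stage_act t r m g x).

Definition kpos_ord m (x : B m) : 'I_m.+2 :=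
  Ordinal (kpos_bound k f x : kpos x < m.+2).

Lemma not_horn_hits m r (j : 'I_m.+1) (g : opmap r m) i : ~ horn j r g ->
  i <> j -> exists l, g l = i.
Proof.
move=> gh ij; apply: contrapT => H; apply: gh; exists i; split=> // l gl.
by apply: H; exists l.
Qed.

(** An operator outside the horn hits every vertex of the cone on x but possibly
    the new one, so x is obtained from the corresponding simplex by a further
    operator; were that simplex in the stage, then x would be, against
    [generating_stage]. *)
Lemma horn_stage m (x : B m) r (g : opmap r m.+1) : generating x ->
  stage (wt x) (act g (C x)) <-> horn (kpos_ord x) r g.
Proof.
move=> xII; have [_ xA _] := xII; have [_ dx] := cone_over_horn xA; split.
  move=> gx; apply: contrapT => gh.
  have [|e ge _] := @op_lift _ _ _ g (coface m (kpos x)) ord0.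
    move=> l; apply: (not_horn_hits gh) => /(congr1 val); exact: coface_neq.
  have : stage (wt x) x.
    rewrite -{2}dx /face -ge act_comp; exact: stage_act.
  by move/(generating_stage xII); rewrite ltnn.
case=> i [ip gi]; rewrite (coface_factor gi) act_comp; apply: stage_act.
apply: generating_face => //; first by rewrite -ltnS.
by move=> ipx; apply: ip; apply: val_inj.
Qed.

(** The simplices added with x are the degeneracies of x and those of C x. *)
Lemma not_horn_split m (x : B m) r (g : opmap r m.+1) :
  ~ horn (kpos_ord x) r g ->
  op_surj g \/
  exists2 h : opmap r m, op_surj h & g = op_comp (coface m (kpos x)) h.
Proof.
move=> gh; have [[l gl]|H] := pselect (exists l, g l = kpos_ord x).
  left=> j; have [->|/eqP jp] := eqVneq j (kpos_ord x); first by exists l.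
  exact: (not_horn_hits gh).
right; have gp l : g l <> kpos_ord x by move=> gl; apply: H; exists l.
exists (op_comp (codegen m (kpos x)) g); last exact: coface_factor gp.
move=> j; have [|l gl] := @not_horn_hits _ _ _ _ (coface m (kpos x) j) gh.
  by move=> /(congr1 val); apply: coface_neq.
exists l; apply: (@coface_inj m (kpos x)).
by have := congr1 (fun u : opmap _ _ => u l) (coface_factor gp) => /= <-.
Qed.

Definition new_cell t :=
  {x : {m & B m} | generating (projT2 x) /\ wt (projT2 x) = t}.

Definition cell_dim t (j : new_cell t) := (projT1 (sval j)).+1.

Lemma cone_inj m (x y : B m) :
  ~ over_horn x -> ~ over_horn y -> C x = C y -> x = y.
Proof.
move=> /cone_over_horn cx /cone_over_horn cy xy.
by have [_ {1}<-] := cx; rewrite -(kpos_cone cx) xy (kpos_cone cy); case: cy.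
Qed.

Lemma cone_face_act m (x : B m) r (h : opmap r m) : ~ over_horn x ->
  act (op_comp (coface m (kpos x)) h) (C x) = act h x.
Proof. by move=> /cone_over_horn[_ dx]; rewrite act_comp -/(face _ _) dx. Qed.

(** A degeneracy of a cone is not a degeneracy of a generating simplex, by
    uniqueness in the Eilenberg-Zilber lemma, as generating simplices are not
    cones. *)
Lemma cell_mixed m m' (x : B m) (x' : B m') r (g : opmap r m.+1)
    (h : opmap r m') :
  generating x -> generating x' -> op_surj g -> op_surj h ->
  act g (C x) <> act h x'.
Proof.
move=> xII xII' gs hs E; have ndC := generating_nondeg xII.
have [_ xA _] := xII; have [ndx' _ _] := xII'.
have mm := EZ_dim ndC ndx' gs hs E; subst m'.
have [Cx _] := EZ_uniq ndC gs E.
exact: (generating_not_cone xII' xA (esym Cx)).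
Qed.

Lemma cell_eq m m' (x : B m) (x' : B m') r (g : opmap r m.+1)
    (g' : opmap r m'.+1) : generating x -> generating x' ->
  ~ horn (kpos_ord x) r g -> ~ horn (kpos_ord x') r g' ->
  act g (C x) = act g' (C x') ->
  existT (fun m => (B m * opmap r m.+1)%type) m (x, g) = existT _ m' (x', g').
Proof.
move=> xII xII' gh gh' E.
have [ndx xA _] := xII; have [ndx' xA' _] := xII'.
have ndC := generating_nondeg xII; have ndC' := generating_nondeg xII'.
have [gs|[h hs gE]] := not_horn_split gh;
  have [gs'|[h' hs' gE']] := not_horn_split gh'.
- have [mm] := EZ_dim ndC ndC' gs gs' E; subst m'.
  by have [/(cone_inj xA xA') -> ->] := EZ_uniq ndC gs E.
- by move: E; rewrite gE' cone_face_act // => /(cell_mixed xII xII' gs hs').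
- by move: E; rewrite gE cone_face_act // => /esym/(cell_mixed xII' xII gs' hs).
- move: E; rewrite gE gE' !cone_face_act // => E.
  have mm := EZ_dim ndx ndx' hs hs' E; subst m'.
  by have [-> ->] := EZ_uniq ndx hs E.
Qed.

Lemma cell_inj t r (j j' : new_cell t) (g : opmap r (cell_dim j))
    (g' : opmap r (cell_dim j')) :
  ~ horn (kpos_ord (projT2 (sval j))) r g ->
  ~ horn (kpos_ord (projT2 (sval j'))) r g' ->
  act g (C (projT2 (sval j))) = act g' (C (projT2 (sval j'))) ->
  existT (fun j => opmap r (@cell_dim t j)) j g = existT _ j' g'.
Proof.
case: j j' g g' => [[m x] jP] [[m' x'] jP'] g g' /=.
move=> gh gh' /(cell_eq (proj1 jP) (proj1 jP') gh gh') E.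
have mm := congr1 (@projT1 _ _) E; rewrite /= in mm; subst m'.
have [xx gg] : (x, g) = (x', g') by apply: eq_from_Tagged E.
by subst x' g'; rewrite (Prop_irrelevance jP jP').
Qed.

End Filtration.

Theorem theorem5p1 (n : nat) (hn : (0 < n)%N) (k : 'I_n.+1)
    (B : sset) (f : smap B (simplex n)) (hf : is_fibration f)
    (A : sset) (m : smap A B) (g : smap A (sub_sset (horn k)))
    (hm : is_pullback g m (horn_incl k) f) :
  strong_anodyne m.
Proof.
have [C [C_cone C_step]] := exists_cone k hf.
have [gm pb] := hm.
(* The universal property on standard simplices: A is the part over the horn. *)
have rangeA r (x : B r) : range (m r) x <-> over_horn k f x.
  split=> [[a _ <-]|xA].
    have := congr1 (fun u : smap A (simplex n) => u r a) gm.
    by rewrite /over_horn /= => <-; exact: (svalP (g r a)).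
  have [|h [[_ mh] _]] := pb (simplex r)
      (yoneda (exist (horn k r) (f r x) xA : sub_sset (horn k) r)) (yoneda x).
    by apply: smap_ext => q t /=; rewrite smap_nat.
  exists (h r (op_id r)) => //.
  have := congr1 (fun u : smap (simplex r) B => u r (op_id r)) mh.
  by rewrite /= act_id.
split.
  move=> Z u v uv.
  have guv : g ∘ u = g ∘ v.
    have sub_eq r (a b : sub_sset (horn k) r) : sval a = sval b -> a = b.
      by case: a b => [a ?] [b ?] ab; apply: eq_exist.
    have E (w : smap Z A) r z : sval ((g ∘ w) r z) = f r ((m ∘ w) r z).
      by have := congr1 (fun t : smap A (simplex n) => t r (w r z)) gm.
    by apply: smap_ext => r z; apply: sub_eq; rewrite !E uv.
  have [|h [_ hu]] := pb Z (g ∘ u) (m ∘ u).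
    apply: smap_ext => r z.
    by have := congr1 (fun t : smap A (simplex n) => t r (u r z)) gm.
  by rewrite -(hu u) // -(hu v).
pose F (x : omega1) : subcomplex B :=
  if x is Some t then stage_sub k f C t
  else @Subcomplex B (fun=> setT) (fun _ _ _ _ => id).
have F_le (a b : omega1) : (a <= b)%O -> sub_le (F a) (F b).
  case: b => [b|] //; case: a => [a|] // ab r x.
  exact: stage_le.
exists _, omega1, F; apply: (@AnodynePresentation _ _ m _ omega1 F omega_wo F_le).
- move=> r; apply/seteqP; split=> [x|x /rangeA]; last by left.
  by case=> [xA|[q [y [h []]]]] //; apply/rangeA.
- by [].
- move=> l /omega_limit -> r; apply/seteqP; split=> // x _.
  exists (Some (wt k f x).+1) => //=; exact: stage_wt.
- move=> a b ab /omega_succ[t [ta tb]]; subst a b.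
  pose J := new_cell k f C t.
  apply: (@horn_attachment _ _ _ _ J (@cell_dim _ _ _ _ C t)
    (fun j => kpos_ord k f (projT2 (sval j))) (fun j => C _ (projT2 (sval j)))).
  + by [].
  + move=> j; have [[_ xA _] xt] := svalP j.
    by apply: stage_C => //; rewrite xt.
  + move=> j q h; have [xII xt] := svalP j.
    by have := horn_stage hn C_cone C_step h xII; rewrite xt.
  + move=> r z /(stage_succ hn C_cone C_step).
    case=> [|[q [x [h [xII xt zE]]]]]; [by left|right].
    by exists (exist _ (existT _ q x) (conj xII xt)), h.
  + by move=> r j j'; apply: (cell_inj hn C_cone C_step).
Qed.
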